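(* Let $d$ be a nonnegative integer and let $G$ be an arbitrary finite simple $d$-regular graph. In the unbiased Chooser-Picker degree game played on $E(G)$, Picker has a strategy which guarantees, against every play of Chooser, that at the end of the game every vertex of $G$ has degree at least $\lfloor d/3\rfloor$ in Picker's subgraph $G_P$. Equivalently, $\delta_P(G)\ge \lfloor d/3\rfloor$.
   Context: Chooser-Picker (also called Client-Waiter) game on the edge set of a graph $G$: in each turn Picker selects a pair of previously unclaimed edges of $G$ and offers them to Chooser. Chooser claims exactly one of the two edges for Chooser's subgraph $G_C$, and the other edge is allocated to Picker's subgraph $G_P$. This continues until all edges of $G$ are claimed; if the total number of edges is odd, the final remaining single edge is automatically assigned to Chooser. In the Chooser-Picker degree game, Chooser is the attacker (Maker), aiming at a large maximum degree in $G_C$, and Picker is the defender (Breaker), aiming at a large minimum degree in $G_P$. For a simple graph $G$, $\delta_P(G)$ denotes the largest integer $t$ such that Picker has a strategy guaranteeing that, at the end of the Chooser-Picker degree game, every vertex of $G$ is incident to at least $t$ edges of $G_P$. *)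

(* Defs.v *)
From mathcomp Require Import all_boot.
Set Implicit Arguments.
Unset Strict Implicit.
Unset Printing Implicit Defensive.

Section Graph.

Variable T : finType.

Definition edges (e : rel T) : {set {set T}} :=
  [set [set p.1; p.2] | p : T * T & e p.1 p.2].

Definition degree (F : {set {set T}}) (v : T) : nat :=
  #|[set f in F | v \in f]|.

Definition simple_graph (e : rel T) : Prop := symmetric e /\ irreflexive e.

Definition regular (e : rel T) (d : nat) : Prop :=
  forall v, degree (edges e) v = d.

(* A turn is recorded as (edge claimed by Chooser, edge left to Picker);
   histories list the most recent turn first. *)
Definition turn : Type := {set T} * {set T}.
Definition history : Type := seq turn.

Definition chooser_edges (h : history) : {set {set T}} :=
  [set f in unzip1 h].

Definition picker_edges (h : history) : {set {set T}} :=
  [set f in unzip2 h].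

Definition unclaimed (e : rel T) (h : history) : {set {set T}} :=
  edges e :\: (chooser_edges h :|: picker_edges h).

Definition legal_offer (e : rel T) (h : history) (p : {set T} * {set T}) :=
  [&& p.1 != p.2, p.1 \in unclaimed e h & p.2 \in unclaimed e h].

(* The two components are the offered edges; their order is irrelevant, since
   Chooser may claim either one. *)
Definition picker_strategy : Type := history -> {set T} * {set T}.

Inductive play (e : rel T) (s : picker_strategy) : history -> Prop :=
| play_start : play e s [::]
| play_turn h f g :
    play e s h -> legal_offer e h (s h) ->
    s h = (f, g) \/ s h = (g, f) ->
    play e s ((f, g) :: h).

Definition legal_strategy (e : rel T) (s : picker_strategy) : Prop :=
  forall h, play e s h -> 1 < #|unclaimed e h| -> legal_offer e h (s h).

Definition no_more_offers (e : rel T) (h : history) : bool :=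
  #|unclaimed e h| <= 1.

(* The final pair (G_C, G_P) once no offer is possible: a single remaining
   edge, if any, goes to Chooser. *)
Definition outcome (e : rel T) (h : history) : {set {set T}} * {set {set T}} :=
  (chooser_edges h :|: unclaimed e h, picker_edges h).

Definition picker_guarantees (e : rel T) (t : nat) : Prop :=
  exists s : picker_strategy,
    legal_strategy e s /\
    forall h, play e s h -> no_more_offers e h ->
      forall v, t <= degree (outcome e h).2 v.

(* [t] is delta_P(G). No such t exists on the empty vertex set, where every
   bound holds vacuously. *)
Definition is_delta_P (e : rel T) (t : nat) : Prop :=
  picker_guarantees e t /\ forall t', picker_guarantees e t' -> t' <= t.

End Graph.

(* Main.v *)
Require Import Defs.
From mathcomp Require Import all_boot.
From Stdlib Require Import Classical_Prop.

(** At each vertex [v], choose [d %/ 3] disjoint groups of three edges; the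
    one or two edges that may be left over belong to no group at [v]. Since an
    edge has two ends, it lies in at most two groups. If Picker gets an edge of
    every group, then every [v] has degree at least [d %/ 3] in Picker's graph,
    so it suffices to hit all groups.

    Picker hits every group by keeping all danger in one place: among the
    groups that Picker has not hit yet, at most one contains an edge of
    Chooser, and it contains only one. Picker offers two free edges of that
    endangered group (or of any group not yet hit, if none is endangered). The
    group is hit whatever Chooser does, and Chooser's new edge lies in at most
    one other group, which may become the new endangered one. Groups of three
    are just large enough: an endangered group still has two free edges. When
    at most one edge is free, a group not yet hit would have at most one edge
    of Chooser and at most one free edge, contradicting its size.

    The invariant is the inequality [danger A h <= 1]. [danger_offer] is the
    move just described, [picker_hits_groups] the resulting strategy, and
    [group_card] and [group_multiplicity] say that the groups are as required.
    For the existence of the largest guaranteed degree, the guaranteed degrees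
    are bounded because every legal strategy admits a complete play. *)

(** * Strategies and plays *)

Lemma legal_offer_unclaimed (T : finType) (e : rel T) (h : history T)
    (p : {set T} * {set T}) : legal_offer e h p -> 1 < #|unclaimed e h|.
Proof.
case/and3P=> neq p1U p2U.
have sub : [set p.1; p.2] \subset unclaimed e h.
  by apply/subsetP=> f; rewrite in_set2 => /orP[] /eqP->.
by move: (subset_leq_card sub); rewrite cards2 neq.
Qed.

Lemma chooser_edges_cons (T : finType) (h : history T) (p : turn T) :
  chooser_edges (p :: h) = p.1 |: chooser_edges h.
Proof. by apply/setP=> f; rewrite !inE. Qed.

Lemma picker_edges_cons (T : finType) (h : history T) (p : turn T) :
  picker_edges (p :: h) = p.2 |: picker_edges h.
Proof. by apply/setP=> f; rewrite !inE. Qed.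

Lemma unclaimed_cons (T : finType) (e : rel T) (h : history T) (p : turn T) :
  unclaimed e (p :: h) = unclaimed e h :\: [set p.1; p.2].
Proof.
by rewrite /unclaimed chooser_edges_cons picker_edges_cons setUACA setUC setDDl.
Qed.

(** The offer at [h] has to preserve the invariant for either answer of
    Chooser. As [inv] is boolean and offers range over a finite type, a
    strategy can search for such an offer instead of being given explicitly. *)
Lemma strategy_of_invariant (T : finType) (e : rel T)
    (inv : history T -> bool) :
  inv [::] ->
  (forall h, inv h -> 1 < #|unclaimed e h| ->
     exists p, [&& legal_offer e h p, inv (p :: h) & inv ((p.2, p.1) :: h)]) ->
  exists s : picker_strategy T,
    legal_strategy e s /\ forall h, play e s h -> inv h.
Proof.
move=> inv0 invS.
pose ok h p := [&& legal_offer e h p, inv (p :: h) & inv ((p.2, p.1) :: h)].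
pose s : picker_strategy T := fun h => odflt (set0, set0) [pick p | ok h p].
have okP h : inv h -> 1 < #|unclaimed e h| -> ok h (s h).
  move=> invh Uh; rewrite /s; case: pickP => //= none.
  by have [p] := invS h invh Uh; rewrite -/(ok h p) none.
have inv_play h : play e s h -> inv h.
  elim=> {h} [|h f g _ invh legal]; first exact: inv0.
  have /and3P[_] := okP h invh (legal_offer_unclaimed _ _ _ _ legal).
  by move=> inv1 inv2 [] eq_s; rewrite eq_s in inv1 inv2.
exists s; split=> // h /inv_play invh Uh.
by case/and3P: (okP h invh Uh).
Qed.

Lemma complete_play (T : finType) (e : rel T) (s : picker_strategy T) :
  legal_strategy e s -> exists2 h, play e s h & no_more_offers e h.
Proof.
move=> legal_s.
have [n] := ubnP #|unclaimed e [::]|.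
elim: n [::] (play_start e s) => // n IHn h play_h; rewrite ltnS => le_n.
have [|lt1] := leqP #|unclaimed e h| 1; first by exists h.
have legal := legal_s h play_h lt1.
apply: (IHn (((s h).1, (s h).2) :: h)).
  by apply: play_turn => //; left; case: (s h).
apply: leq_trans le_n; apply: proper_card; rewrite unclaimed_cons.
case/and3P: legal => _ s1U _.
apply/properP; split; first exact: subsetDl.
by exists (s h).1; rewrite // !inE eqxx.
Qed.

(** Some complete play is needed here: a strategy without one would guarantee
    every degree vacuously. *)
Lemma guarantee_bounded (T : finType) (e : rel T) (t : nat) (v : T) :
  picker_guarantees e t -> t <= #|{set T}|.
Proof.
case=> s [legal_s good]; have [h play_h end_h] := complete_play T e s legal_s.
exact: leq_trans (good h play_h end_h v) (max_card _).
Qed.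

Lemma ex_max_of_bounded (P : nat -> Prop) (m t : nat) :
  P t -> (forall t', P t' -> t' <= m) ->
  exists t', [/\ P t', forall t'', P t'' -> t'' <= t' & t <= t'].
Proof.
move=> Pt bound; have [n] := ubnP (m - t).
elim: n t Pt => // n IHn t Pt lt_n.
case: (classic (exists2 t', P t' & t < t')) => [[t' Pt' lt_t]|max_t].
  have [|u [Pu max_u le_u]] := IHn t' Pt'.
    rewrite ltnS in lt_n; apply: leq_trans lt_n.
    by apply: ltn_sub2l => //; apply: leq_trans lt_t (bound _ Pt').
  by exists u; split=> //; apply: leq_trans (ltnW lt_t) le_u.
exists t; split=> // u Pu; rewrite leqNgt; apply/negP=> lt_t.
by apply: max_t; exists u.
Qed.

(** * Hitting groups of three *)

Definition unhit (T I : finType) (A : I -> {set {set T}}) (h : history T)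
    (i : I) : bool :=
  A i :&: picker_edges h == set0.

(** A single number bounded by 1 expresses both that at most one unhit group
    is endangered and that Chooser has at most one edge there. *)
Definition danger (T I : finType) (A : I -> {set {set T}}) (h : history T) :
    nat :=
  \sum_(i | unhit T I A h i) #|A i :&: chooser_edges h|.

Lemma unhit_consP (T I : finType) (A : I -> {set {set T}}) (h : history T)
    (f g : {set T}) (i : I) :
  unhit T I A ((f, g) :: h) i -> unhit T I A h i /\ g \notin A i.
Proof.
move=> /eqP/setP unhit_i; split.
  apply/eqP/setP=> x; have := unhit_i x.
  rewrite picker_edges_cons !in_setI in_setU in_set0.
  by case: (x \in A i) => //= /norP[_ /negbTE].
have := unhit_i g; rewrite picker_edges_cons in_setI setU11 andbT in_set0.
by move=> ->.
Qed.

(** Every edge of an unhit group is Chooser's or free. Used both during the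
    game, to find two free edges in an endangered group, and at its end, to
    rule out unhit groups. *)
Lemma card_group_claimed (T I : finType) (e : rel T) (A : I -> {set {set T}})
    (h : history T) (i : I) :
  A i \subset edges e -> unhit T I A h i ->
  #|A i| <= #|A i :&: chooser_edges h| + #|A i :&: unclaimed e h|.
Proof.
move=> /subsetP sAe /eqP/setP unhit_i.
apply: leq_trans (leq_card_setU _ _); apply/subset_leq_card/subsetP=> x xA.
have := unhit_i x; rewrite in_setI xA in_set0 /= => xP.
rewrite in_setU !in_setI xA /= in_setD in_setU xP orbF (sAe x xA) andbT.
by case: (x \in chooser_edges h).
Qed.

(** Once both offered edges lie in group [i] and no other unhit group is
    endangered, Chooser's new edge [f] is the only source of danger; it lies
    in [A i], which becomes hit, and in at most one other group. *)
Lemma danger_cons (T I : finType) (A : I -> {set {set T}}) (h : history T)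
    (f g : {set T}) (i : I) :
  #|[set j | f \in A j]| <= 2 -> f \in A i -> g \in A i ->
  (forall j, j != i -> unhit T I A h j -> A j :&: chooser_edges h = set0) ->
  danger T I A ((f, g) :: h) <= 1.
Proof.
move=> multf fA gA safe.
have iF : i \in [set j | f \in A j] by rewrite inE.
rewrite (cardsD1 i) iF ltnS in multf; apply: leq_trans multf.
rewrite -sum1_card /danger big_mkcond [X in _ <= X]big_mkcond /=.
apply: leq_sum => j _; case: ifP => // /unhit_consP[unhit_j gNA].
have neq : j != i by apply: contraNneq gNA => ->.
have newC : A j :&: chooser_edges ((f, g) :: h) \subset A j :&: [set f].
  by rewrite chooser_edges_cons setIUr (safe j neq unhit_j) setU0.
apply: leq_trans (subset_leq_card newC) _.
rewrite !inE neq /=; case: ifP => [_|fNA].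
  by apply: leq_trans (subset_leq_card (subsetIr _ _)) _; rewrite cards1.
by rewrite leqn0 cards_eq0 setIC setI_eq0 disjoints1 fNA.
Qed.

(** The group from which Picker offers next: the endangered one if there is
    one, and otherwise any unhit group, since then nothing is in danger. *)
Lemma endangered_unhit (T I : finType) (A : I -> {set {set T}})
    (h : history T) (i0 : I) :
  danger T I A h <= 1 -> unhit T I A h i0 ->
  exists i, [/\ unhit T I A h i, #|A i :&: chooser_edges h| <= 1 &
    forall j, j != i -> unhit T I A h j -> A j :&: chooser_edges h = set0].
Proof.
move=> danger1 unhit0.
have [i /andP[unhit_i nz]|safe] :=
  pickP (fun i => unhit T I A h i && (A i :&: chooser_edges h != set0)).
  move: danger1; rewrite /danger (bigD1 i) //= -card_gt0 in nz * => le1.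
  exists i; split=> // [|j neq unhit_j].
    exact: leq_trans (leq_addr _ _) le1.
  apply/eqP; rewrite -cards_eq0 -leqn0.
  rewrite (bigD1 j) ?unhit_j //= in le1.
  by move: le1 nz; do 2!case: #|_| => [|?] //; rewrite addSn addnS.
have zero j : unhit T I A h j -> A j :&: chooser_edges h = set0.
  by move=> unhit_j; have := safe j; rewrite unhit_j /= => /negbFE/eqP.
by exists i0; split=> // [|j _]; [rewrite zero // cards0 | exact: zero].
Qed.

Lemma danger_offer (T I : finType) (e : rel T) (A : I -> {set {set T}})
    (h : history T) :
  (forall i, A i \subset edges e) -> (forall i, 2 < #|A i|) ->
  (forall f, f \in edges e -> #|[set i | f \in A i]| <= 2) ->
  danger T I A h <= 1 -> 1 < #|unclaimed e h| ->
  exists p, [&& legal_offer e h p, danger T I A (p :: h) <= 1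
              & danger T I A ((p.2, p.1) :: h) <= 1].
Proof.
move=> sAe gt2 mult danger1 gt1U.
have [i0 unhit0|all_hit] := pickP (unhit T I A h).
  have [i [unhit_i le1 safe]] := endangered_unhit T I A h i0 danger1 unhit0.
  have : 1 < #|A i :&: unclaimed e h|.
    have := leq_trans (gt2 i) (card_group_claimed T I e A h i (sAe i) unhit_i).
    move=> /leq_trans/(_ (leq_add le1 (leqnn _))).
    by rewrite add1n ltnS.
  case/card_gt1P=> f [g [/setIP[fA fU] /setIP[gA gU] neq]].
  exists (f, g); rewrite /legal_offer /= neq fU gU /=.
  by apply/andP; split; apply: (danger_cons T I A h _ _ i) => //;
    apply: mult; apply: (subsetP (sAe i)).
have [f [g [fU gU neq]]] := card_gt1P gt1U.
have no_danger p : danger T I A (p :: h) <= 1.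
  case: p => x y; rewrite /danger big_pred0 // => i.
  by apply/negP=> /unhit_consP[]; rewrite all_hit.
by exists (f, g); rewrite /legal_offer /= neq fU gU !no_danger.
Qed.

Lemma picker_hits_groups (T I : finType) (e : rel T) (A : I -> {set {set T}}) :
  (forall i, A i \subset edges e) -> (forall i, 2 < #|A i|) ->
  (forall f, f \in edges e -> #|[set i | f \in A i]| <= 2) ->
  exists s : picker_strategy T, legal_strategy e s /\
    forall h, play e s h -> no_more_offers e h ->
    forall i, exists2 f, f \in A i & f \in picker_edges h.
Proof.
move=> sAe gt2 mult.
have [||s [legal_s inv_s]] :=
    strategy_of_invariant T e (fun h => danger T I A h <= 1).
- rewrite /danger big1 // => i _; apply/eqP; rewrite cards_eq0.
  by apply/eqP/setP=> x; rewrite !inE andbF.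
- by move=> h; apply: danger_offer.
exists s; split=> // h /inv_s danger1 end_h i.
have [unhit_i|] := boolP (unhit T I A h i); last first.
  by case/set0Pn=> f /setIP[fA fP]; exists f.
have leC : #|A i :&: chooser_edges h| <= 1.
  apply: leq_trans danger1; rewrite /danger (bigD1 i) //=; exact: leq_addr.
have leU : #|A i :&: unclaimed e h| <= 1.
  by apply: leq_trans end_h; apply/subset_leq_card/subsetIr.
have := leq_trans (card_group_claimed T I e A h i (sAe i) unhit_i)
                  (leq_add leC leU).
by rewrite leqNgt gt2.
Qed.

(** * The groups of edges at a vertex *)

Definition incident (T : finType) (e : rel T) (v : T) : {set {set T}} :=
  [set f in edges e | v \in f].

(** Ranks cut an enumeration of the edges at [v] into consecutive triples. *)
Definition rank_at (T : finType) (e : rel T) (v : T) (f : {set T}) : nat :=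
  index f (enum (incident T e v)) %/ 3.

Definition group (T : finType) (e : rel T) (k : nat) (vi : T * 'I_k) :
    {set {set T}} :=
  [set f in incident T e vi.1 | rank_at T e vi.1 f == vi.2].

Lemma group_card (T : finType) (e : rel T) (d : nat) (vi : T * 'I_(d %/ 3)) :
  regular e d -> 2 < #|group T e (d %/ 3) vi|.
Proof.
case: vi => v i reg; set A := group _ _ _ _.
pose s := enum (incident T e v).
have size_s : size s = d by rewrite -cardE; apply: reg.
have lt_d j : j < 3 -> i * 3 + j < size s.
  move=> lt3; rewrite size_s.
  have : (i.+1) * 3 <= d by rewrite -leq_divRL.
  by apply: leq_trans; rewrite mulSnr ltn_add2l.
pose l := [seq nth set0 s (i * 3 + j) | j <- iota 0 3].
have uniq_l : uniq l.
  rewrite map_inj_in_uniq ?iota_uniq // => j1 j2.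
  rewrite !mem_iota /= !add0n => lt1 lt2 /eqP.
  by rewrite nth_uniq ?lt_d ?enum_uniq // eqn_add2l => /eqP.
rewrite cardE -[3]/(size l); apply: uniq_leq_size => // f /mapP[j].
rewrite mem_iota add0n /= => lt3 ->; rewrite mem_enum /A /group in_set /=.
apply/andP; split.
  by rewrite -mem_enum mem_nth // lt_d.
rewrite /rank_at -/s index_uniq ?lt_d ?enum_uniq //.
by rewrite divnMDl // (divn_small lt3) addn0.
Qed.

(** Inside the groups of a fixed vertex an edge has a single position, so the
    groups containing an edge are told apart by their vertices. *)
Lemma group_multiplicity (T : finType) (e : rel T) (k : nat) (f : {set T}) :
  f \in edges e -> #|[set vi | f \in group T e k vi]| <= 2.
Proof.
move=> fE; set S := [set _ | _].
have inj : {in S &, injective (@fst T 'I_k)}.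
  move=> [v i] [w j]; rewrite /S /group !inE /=.
  move=> /andP[_ /eqP ri] /andP[_ /eqP rj] eq_vw.
  by subst w; congr pair; apply: val_inj; rewrite /= -ri -rj.
rewrite -(card_in_imset inj).
have sub : [set vi.1 | vi in S] \subset f.
  apply/subsetP=> v /imsetP[vi]; rewrite /S /group !inE => /andP[/andP[_ vf] _].
  by move=> ->.
apply: leq_trans (subset_leq_card sub) _.
by case/imsetP: fE => p _ ->; rewrite cards2; case: (_ != _).
Qed.

(** Edges of different groups at [v] have different ranks, so the ranks of the
    edges of [P] at [v] take all [k] values. *)
Lemma hit_groups_degree (T : finType) (e : rel T) (k : nat)
    (P : {set {set T}}) (v : T) :
  (forall i, exists2 f, f \in group T e k (v, i) & f \in P) ->
  k <= degree P v.
Proof.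
move=> hit; rewrite /degree cardE -(size_map (rank_at T e v)) -{1}(size_iota 0 k).
apply: uniq_leq_size (iota_uniq _ _) _ => i; rewrite mem_iota add0n /= => lt_ik.
have [f] := hit (Ordinal lt_ik).
rewrite /group !inE /= => /andP[/andP[_ vf] /eqP rank_f] fP.
by rewrite -rank_f map_f // mem_enum inE fP vf.
Qed.

Theorem theorem2 (d : nat) (T : finType) (e : rel T)
    (e_simple : simple_graph e) (e_regular : regular e d) :
  picker_guarantees e (d %/ 3) /\
  (0 < #|T| -> exists t : nat, is_delta_P e t /\ d %/ 3 <= t).
Proof.
have guarantee : picker_guarantees e (d %/ 3).
  have [|||s [legal_s hit]] :=
      picker_hits_groups T (T * 'I_(d %/ 3))%type e (group T e (d %/ 3)).
  - by move=> vi; apply/subsetP=> f; rewrite /group !inE => /andP[/andP[]].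
  - by move=> vi; apply: group_card.
  - exact: group_multiplicity.
  exists s; split=> // h play_h end_h v.
  by apply: (hit_groups_degree T e) => i; apply: hit.
split=> // /card_gt0P[v _].
have [t [guar_t max_t le_t]] := ex_max_of_bounded _ _ _ guarantee
  (fun t' => guarantee_bounded T e t' v).
by exists t.
Qed.
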